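(* Let $\mathcal{X}\subset\mathbb{R}^n$ and let $\mathscr{M}$ be a finite set. Suppose that the target variables $\mathbf{g}:\mathcal{X}\to\mathbb{R}^q$ and measurements $\mathbf{m}_j:\mathcal{X}\to\mathbb{R}^{d_j}$, $j\in\mathscr{M}$, are measurable functions, and let $\mu$ and $\nu$ be measures on $\mathcal{X}$. Let $\gamma>0$ and $\varepsilon\geq0$, and for $\mathscr{S}\subseteq\mathscr{M}$ define $$f(\mathscr{S})=\int_{\substack{(\mathbf{x},\mathbf{x}')\in\mathcal{X}\times\mathcal{X}:\\ \Vert\mathbf{g}(\mathbf{x})-\mathbf{g}(\mathbf{x}')\Vert_2\geq\varepsilon}}w_{\gamma,\mathbf{x},\mathbf{x}'}(\mathscr{S})\,\Vert\mathbf{g}(\mathbf{x})-\mathbf{g}(\mathbf{x}')\Vert_2^2\,d\mu(\mathbf{x})\,d\nu(\mathbf{x}'),$$ $$w_{\gamma,\mathbf{x},\mathbf{x}'}(\mathscr{S})=\min\left\{\frac{1}{\gamma^2}\Vert\mathbf{m}_{\mathscr{S}}(\mathbf{x})-\mathbf{m}_{\mathscr{S}}(\mathbf{x}')\Vert_2^2,\ 1\right\},$$ and assume $f$ is finite-valued. Then $f$ is normalized so that $f(\emptyset)=0$, monotone non-decreasing so that $\mathscr{S}\subseteq\mathscr{S}'\Rightarrow f(\mathscr{S})\leq f(\mathscr{S}')$, and submodular.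
   Context: For $\mathscr{S}\subseteq\mathscr{M}$, $\mathbf{m}_{\mathscr{S}}=(\mathbf{m}_j)_{j\in\mathscr{S}}$ is the concatenated measurement, so $\Vert\mathbf{m}_{\mathscr{S}}(\mathbf{x})-\mathbf{m}_{\mathscr{S}}(\mathbf{x}')\Vert_2^2=\sum_{j\in\mathscr{S}}\Vert\mathbf{m}_j(\mathbf{x})-\mathbf{m}_j(\mathbf{x}')\Vert_2^2$. The integral is with respect to the product of $\mu$ and $\nu$. A real-valued function $f:2^{\mathscr{M}}\to\mathbb{R}$ on subsets of $\mathscr{M}$ is submodular if for all $j\in\mathscr{M}$ and $\mathscr{S}\subseteq\mathscr{S}'\subseteq\mathscr{M}\setminus\{j\}$, $f(\mathscr{S}\cup\{j\})-f(\mathscr{S})\geq f(\mathscr{S}'\cup\{j\})-f(\mathscr{S}')$. *)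

(* Defs.v *)
From HB Require Import structures.
From mathcomp Require Import all_boot all_order all_algebra.
From mathcomp Require Import all_classical all_reals all_analysis.
Set Implicit Arguments.
Unset Strict Implicit.
Unset Printing Implicit Defensive.
Import Order.TTheory GRing.Theory Num.Theory.
Import numFieldNormedType.Exports.
Local Open Scope classical_set_scope.
Local Open Scope ring_scope.

Notation borelType T := (g_sigma_algebraType (@open T)).

(* A subset X of R^n, as a measurable space. The topology of [subspace X] is the
   relative topology on X and is discrete off X, so a set A is measurable here
   iff A `&` X is the trace on X of a Borel set of R^n (lemma
   [measurable_borel_onP]); X is not assumed to be Borel or nonempty. The carrier
   is all of R^n, because a measurableType is never empty: a measure on X is
   represented by any measure on [borel_on X] with the same values on the
   subsets of X, and a function on X by any total function that agrees with it
   on X. *)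
Notation borel_on X := (borelType (subspace X)).

Lemma measurable_borel_onP (R : realType) (n : nat) (X : set 'rV[R]_n)
    (A : set 'rV[R]_n) :
  measurable (A : set (borel_on X)) <->
  exists2 B, measurable (B : set (borelType 'rV[R]_n)) & A `&` X = B `&` X.
Proof.
split.
- move=> mA; pose G := [set A : set 'rV[R]_n |
    exists2 B, measurable (B : set (borelType 'rV[R]_n)) & A `&` X = B `&` X].
  suff : <<s (@open (subspace X)) >> `<=` G by apply.
  apply: smallest_sub.
  + split.
    * by exists set0; first exact: measurable0.
    * move=> C [B mB CB]; exists (~` B); first exact: measurableC.
      rewrite setTD; apply/seteqP; split => x [Cx Xx]; split => // Hx; apply: Cx.
        by have [] : (C `&` X) x by rewrite CB.
      by have [] : (B `&` X) x by rewrite -CB.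
    * move=> F mF; have /choice[B HB] : forall i, exists B,
        measurable (B : set (borelType 'rV[R]_n)) /\ F i `&` X = B `&` X.
        by move=> i; have [B] := mF i; exists B.
      exists (\bigcup_i B i).
        by apply: bigcupT_measurable => i; have [] := HB i.
      by rewrite !setI_bigcupl; apply: eq_bigcupr => i _; have [] := HB i.
  + move=> U /open_subspaceP[V oV VU]; exists V; last exact/esym.
    exact: sub_sigma_algebra.
- move=> [B mB AB].
  have mX : measurable (X : set (borel_on X)).
    by apply: sub_sigma_algebra; exact: open_subspaceT.
  have mI (C : set 'rV[R]_n) : C `<=` ~` X -> measurable (C : set (borel_on X)).
    by move=> CX; apply: sub_sigma_algebra; exact: open_subspace_out.
  suff mBX : measurable (B : set (borel_on X)).
    rewrite -(setUIDK A X) AB; apply: measurableU; first exact: measurableI.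
    by apply: mI; exact: subIsetr.
  have : <<s (@open 'rV[R]_n) >> `<=` <<s (@open (subspace X)) >>; last by apply.
  apply: smallest_sub; first exact: smallest_sigma_algebra.
  by move=> U oU; apply: sub_sigma_algebra; exact: open_subspaceW.
Qed.

(* The Euclidean norm; the library's norm on 'rV[R]_n is the sup norm. *)
Definition l2norm (R : realType) (n : nat) (v : 'rV[R]_n) : R :=
  Num.sqrt (\sum_(i < n) v 0 i ^+ 2).

Definition stack_index (M : finType) (d : M -> nat) (S : {set M}) :
    {set {j : M & 'I_(d j)}} :=
  [set p | tag p \in S].

(* The concatenation m_S = (m_j)_{j in S}: its coordinates are indexed by the
   pairs (j, k) with j in S and k < d_j. *)
Definition stack (R : realType) (T : Type) (M : finType) (d : M -> nat)
    (m : forall j, T -> 'rV[R]_(d j)) (S : {set M}) (x : T) :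
    'rV[R]_(#|stack_index d S|) :=
  \row_k m (tag (enum_val k)) x 0 (tagged (enum_val k)).

Lemma l2norm_stackB (R : realType) (T : Type) (M : finType) (d : M -> nat)
    (m : forall j, T -> 'rV[R]_(d j)) (S : {set M}) (x x' : T) :
  l2norm (stack m S x - stack m S x') ^+ 2 =
  \sum_(j in S) l2norm (m j x - m j x') ^+ 2.
Proof.
rewrite /l2norm sqr_sqrtr; last by apply: sumr_ge0 => i _; exact: sqr_ge0.
under eq_bigr do rewrite !mxE.
rewrite -(@big_enum_val _ _ _ _ (mem (stack_index d S)) (fun p =>
  (m (tag p) x 0 (tagged p) - m (tag p) x' 0 (tagged p)) ^+ 2)) /=.
under eq_bigl do rewrite inE.
rewrite [RHS](eq_bigr (fun j =>
  \sum_(i < d j | true) (m j x 0 i - m j x' 0 i) ^+ 2)); last first.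
  move=> j _; rewrite sqr_sqrtr; last by apply: sumr_ge0 => i _; exact: sqr_ge0.
  by apply: eq_bigr => i _; rewrite !mxE.
by rewrite sig_big_dep; apply: eq_bigl => p; rewrite andbT.
Qed.

Definition weight (R : realType) (T : Type) (M : finType) (d : M -> nat)
    (m : forall j, T -> 'rV[R]_(d j)) (gamma : R) (x x' : T) (S : {set M}) : R :=
  Num.min (1 / gamma ^+ 2 * l2norm (stack m S x - stack m S x') ^+ 2) 1.

(* rho is a product of mu and nu. For sigma-finite measures this determines rho
   (lemma [is_product_measureP]); in general there may be several products, and
   no particular one is singled out. *)
Definition is_product_measure (R : realType) (d1 d2 : measure_display)
    (T1 : measurableType d1) (T2 : measurableType d2)
    (mu : {measure set T1 -> \bar R}) (nu : {measure set T2 -> \bar R})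
    (rho : {measure set (T1 * T2)%type -> \bar R}) : Prop :=
  forall A B, measurable A -> measurable B -> rho (A `*` B) = (mu A * nu B)%E.

Lemma is_product_measureP (R : realType) (d1 d2 : measure_display)
    (T1 : measurableType d1) (T2 : measurableType d2)
    (mu : {sigma_finite_measure set T1 -> \bar R})
    (nu : {sigma_finite_measure set T2 -> \bar R})
    (rho : {measure set (T1 * T2)%type -> \bar R}) :
  is_product_measure mu nu rho <->
  forall A, measurable A -> rho A = (mu \x nu)%E A.
Proof.
split=> [pr A mA|E A B mA mB]; first exact/esym/product_measure_unique.
by rewrite E; [exact: product_measure1E|exact: measurableX].
Qed.

(* The integral defining f(S), before it is assumed to be finite. *)
Definition objective (R : realType) (n q : nat) (X : set 'rV[R]_n) (M : finType)
    (d : M -> nat) (g : 'rV[R]_n -> 'rV[R]_q)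
    (m : forall j, 'rV[R]_n -> 'rV[R]_(d j)) (gamma eps : R)
    (rho : {measure set (borel_on X * borel_on X)%type -> \bar R})
    (S : {set M}) : \bar R :=
  let D := [set p : 'rV[R]_n * 'rV[R]_n |
    [/\ X p.1, X p.2 & l2norm (g p.1 - g p.2) >= eps]] in
  (\int[rho]_(p in D)
    (weight m gamma p.1 p.2 S * l2norm (g p.1 - g p.2) ^+ 2)%:E)%E.

Arguments objective {R n q} X {M d} g m gamma eps rho S.

Definition normalized (R : realType) (M : finType) (f : {set M} -> R) : Prop :=
  f finset.set0 = 0.

Definition nondecreasing_setfun (R : realType) (M : finType)
    (f : {set M} -> R) : Prop :=
  forall S S' : {set M}, S \subset S' -> f S <= f S'.

Definition submodular (R : realType) (M : finType) (f : {set M} -> R) : Prop :=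
  forall (j : M) (S S' : {set M}),
    S \subset S' -> S' \subset ~: [set j] ->
    f (S :|: [set j]) - f S >= f (S' :|: [set j]) - f S'.

(* Main.v *)
Require Import Defs.
From HB Require Import structures.
From mathcomp Require Import all_boot all_order all_algebra.
From mathcomp Require Import lra.
From mathcomp Require Import all_classical all_reals all_analysis.
From mathcomp Require Import measurable_realfun.
Set Implicit Arguments.
Unset Strict Implicit.
Unset Printing Implicit Defensive.
Import Order.TTheory GRing.Theory Num.Theory.
Import numFieldNormedType.Exports.
Local Open Scope classical_set_scope.
Local Open Scope ring_scope.

(** The squared distance between concatenated measurements is a sum over
    the indices in S, hence a modular function of S with nonnegative increments.
    Truncating a modular nondecreasing function by a constant (more generally,
    composing it with a nondecreasing concave function) gives a nondecreasing
    submodular one; so for each fixed pair (x, x') the weight is normalized,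
    nondecreasing and submodular ([weight_set0], [weight_nondecreasing],
    [weight_submodular]). The objective integrates these weights against
    a nonnegative factor, and all three properties are linear relations
    (equalities or inequalities) between values of the set function, so they pass to the integral
    ([nondecreasing_integral], [submodular_integral]).

    Linearity of the integral requires measurability of the integrand and of
    the domain of integration. Both reduce to the fact that the squared
    Euclidean distance is a polynomial in the coordinates, which are continuous
    and therefore Borel ([measurable_l2distX], [measurable_l2dist]). *)

(** The increment over [t] of the concave function [min(_, c)] decreases as
    the base point moves from [a] up to [b]. *)
Lemma min_diminishing (R : realDomainType) (a b t c : R) :
  a <= b -> 0 <= t ->
  Num.min (b + t) c - Num.min b c <= Num.min (a + t) c - Num.min a c.
Proof.
by move=> ab t0; case: (leP (b + t)); case: (leP b);
  case: (leP (a + t)); case: (leP a); lra.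
Qed.

Section weight.
Context (R : realType) (T : Type) (M : finType) (d : M -> nat).
Variables (m : forall j, T -> 'rV[R]_(d j)) (gamma : R) (x x' : T).

Let a (j : M) : R := 1 / gamma ^+ 2 * l2norm (m j x - m j x') ^+ 2.

Let a_ge0 j : 0 <= a j.
Proof. by rewrite mulr_ge0 ?divr_ge0 ?sqr_ge0. Qed.

Lemma weightE (S : {set M}) :
  weight m gamma x x' S =
  Num.min (\sum_(j in S) 1 / gamma ^+ 2 * l2norm (m j x - m j x') ^+ 2) 1.
Proof. by rewrite /weight l2norm_stackB mulr_sumr. Qed.

Lemma weight_ge0 (S : {set M}) : 0 <= weight m gamma x x' S.
Proof.
by rewrite weightE le_min ler01 andbT; apply: sumr_ge0 => j _; exact: a_ge0.
Qed.

Lemma weight_set0 : normalized (weight m gamma x x').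
Proof. by rewrite /normalized weightE big_set0 min_l. Qed.

Let sum_subset (S S' : {set M}) :
  S \subset S' -> \sum_(j in S) a j <= \sum_(j in S') a j.
Proof.
move=> SS'; rewrite [leRHS](big_setID S) /= (finset.setIidPr SS') lerDl.
by apply: sumr_ge0 => j _; exact: a_ge0.
Qed.

Lemma weight_nondecreasing : nondecreasing_setfun (weight m gamma x x').
Proof.
move=> S S' SS'; rewrite !weightE le_min ge_min ge_min lexx orbT andbT.
by rewrite sum_subset.
Qed.

Lemma weight_submodular : submodular (weight m gamma x x').
Proof.
move=> j S S' SS' S'j; rewrite !weightE.
have jS' : j \notin S' by apply/negP => /(fintype.subsetP S'j); rewrite !inE eqxx.
have jS : j \notin S by apply: contra jS'; exact: (fintype.subsetP SS').
rewrite !(finset.setUC _ [set j]) !big_setU1 //= ![1 / _ * _ + _]addrC.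
by apply: min_diminishing; [exact: sum_subset|exact: a_ge0].
Qed.

End weight.

Lemma nondecreasing_setfunMr (R : realType) (M : finType) (f : {set M} -> R)
    (c : R) : 0 <= c -> nondecreasing_setfun f ->
  nondecreasing_setfun (fun S => f S * c).
Proof. by move=> c0 nf S S' SS'; rewrite ler_wpM2r // nf. Qed.

Lemma submodularMr (R : realType) (M : finType) (f : {set M} -> R) (c : R) :
  0 <= c -> submodular f -> submodular (fun S => f S * c).
Proof.
by move=> c0 sf j S S' SS' S'j; rewrite -!mulrBl ler_wpM2r // sf.
Qed.

Section integral_setfun.
Context (disp : measure_display) (T : measurableType disp) (R : realType).
Context (M : finType) (mu : {measure set T -> \bar R}) (D : set T).
Variable h : T -> {set M} -> R.
Hypotheses (mD : measurable D) (mh : forall S, measurable_fun D (h ^~ S)).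
Hypothesis h_ge0 : forall x S, 0 <= h x S.
Hypothesis h_fin : forall S, (\int[mu]_(x in D) (h x S)%:E)%E \is a fin_num.

Let mhE S : measurable_fun D (EFin \o h ^~ S).
Proof. exact/measurable_EFinP. Qed.

Lemma nondecreasing_integral : (forall x, nondecreasing_setfun (h x)) ->
  nondecreasing_setfun (fun S => fine (\int[mu]_(x in D) (h x S)%:E)%E).
Proof.
move=> nh S S' SS'; apply: fine_le => //.
apply: ge0_le_integral => //.
- by move=> x _; rewrite lee_fin.
- exact: mhE.
- exact: mhE.
- by move=> x _; rewrite lee_fin nh.
Qed.

(** Submodularity is rearranged into an inequality between sums, so that only
    additivity of the integral on nonnegative functions is needed. *)
Lemma submodular_integral : (forall x, submodular (h x)) ->
  submodular (fun S => fine (\int[mu]_(x in D) (h x S)%:E)%E).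
Proof.
move=> sh j S S' SS' S'j.
have addE A B : (\int[mu]_(x in D) (h x A)%:E + \int[mu]_(x in D) (h x B)%:E =
    \int[mu]_(x in D) (h x A + h x B)%:E)%E.
  under [RHS]eq_integral do rewrite EFinD.
  rewrite ge0_integralD //.
  - by move=> x _; rewrite lee_fin.
  - exact: mhE.
  - by move=> x _; rewrite lee_fin.
  - exact: mhE.
rewrite lerBrDr addrAC lerBlDr -!fineD // !addE.
apply: fine_le; [by rewrite -addE fin_numD !h_fin|by rewrite -addE fin_numD !h_fin|].
apply: ge0_le_integral => //.
- by move=> x _; rewrite lee_fin addr_ge0.
- by apply/measurable_EFinP; exact: measurable_funD.
- by apply/measurable_EFinP; exact: measurable_funD.
- by move=> x _; rewrite lee_fin -lerBlDr addrAC -lerBrDr sh.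
Qed.

End integral_setfun.

Lemma measurable_coord (R : realType) (k : nat) (i : 'I_k) :
  measurable_fun setT ((fun v => v 0 i) : borelType 'rV[R]_k -> R).
Proof.
apply: (measurability _ (RGenOpens.measurableE R)).
move=> _ [_ [a [b ->] <-]]; rewrite setTI; apply: sub_sigma_algebra.
have /continuousP := @coord_continuous R 1 k 0 i.
by apply; exact: interval_open.
Qed.

Section l2dist.
Context (R : realType) (disp : measure_display) (T : measurableType disp).
Context (X : set T) (k : nat) (f : T -> borelType 'rV[R]_k).
Hypotheses (mX : measurable X) (mf : measurable_fun X f).

Lemma measurable_l2distX :
  measurable_fun (X `*` X) (fun p => l2norm (f p.1 - f p.2 : 'rV[R]_k) ^+ 2).
Proof.
have mfi i : measurable_fun X (fun x => (f x : 'rV[R]_k) 0 i).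
  exact: measurableT_comp (measurable_coord i) mf.
rewrite (_ : (fun p => _) = fun p =>
  \sum_(i < k) ((f p.1 : 'rV[R]_k) 0 i - (f p.2 : 'rV[R]_k) 0 i) ^+ 2).
  apply: measurable_sum => i; apply: measurable_funX; apply: measurable_funB.
    apply: (measurable_comp mX _ (mfi i)) => [_ [p [Xp _] <-//]|].
    exact: measurable_funTS measurable_fst.
  apply: (measurable_comp mX _ (mfi i)) => [_ [p [_ Xp] <-//]|].
  exact: measurable_funTS measurable_snd.
apply/funext => p; rewrite /l2norm sqr_sqrtr.
  by apply: eq_bigr => i _; rewrite !mxE.
by apply: sumr_ge0 => i _; exact: sqr_ge0.
Qed.

(** Needed to cut out the pairs at distance at least eps; the square root is
    continuous, so this follows from the squared case. *)
Lemma measurable_l2dist :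
  measurable_fun (X `*` X) (fun p => l2norm (f p.1 - f p.2 : 'rV[R]_k)).
Proof.
rewrite (_ : (fun p => _) = fun p =>
  Num.sqrt (l2norm (f p.1 - f p.2 : 'rV[R]_k) ^+ 2)).
  apply: (measurableT_comp _ measurable_l2distX).
  by apply: continuous_measurable_fun; exact: sqrt_continuous.
by apply/funext => p; rewrite sqrtr_sqr ger0_norm // sqrtr_ge0.
Qed.

End l2dist.

Theorem lemmaB3 (R : realType) (n q : nat) (X : set 'rV[R]_n) (M : finType)
    (d : M -> nat) (g : 'rV[R]_n -> 'rV[R]_q)
    (m : forall j : M, 'rV[R]_n -> 'rV[R]_(d j))
    (mg : measurable_fun (X : set (borel_on X))
      (g : borel_on X -> borelType 'rV[R]_q))
    (mm : forall j : M,
      measurable_fun (X : set (borel_on X))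
        (m j : borel_on X -> borelType 'rV[R]_(d j)))
    (mu nu : {measure set (borel_on X) -> \bar R})
    (rho : {measure set (borel_on X * borel_on X)%type -> \bar R})
    (rho_product : is_product_measure mu nu rho)
    (gamma eps : R) (gamma_gt0 : 0 < gamma) (eps_ge0 : 0 <= eps)
    (f_finite : forall S : {set M},
      objective X g m gamma eps rho S \is a fin_num) :
  let f (S : {set M}) : R := fine (objective X g m gamma eps rho S) in
  [/\ normalized f, nondecreasing_setfun f & submodular f].
Proof.
(* X is open in its own relative topology, so it is measurable even when it is
   not a Borel subset of the ambient space. *)
have mX : measurable (X : set (borel_on X)).
  by apply: sub_sigma_algebra; exact: open_subspaceT.
set D := [set p : borel_on X * borel_on X |
  [/\ X p.1, X p.2 & l2norm (g p.1 - g p.2) >= eps]].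
have DXX : D `<=` X `*` X by move=> p [].
have mXX : measurable (X `*` X : set (borel_on X * borel_on X)).
  exact: measurableX.
have mD : measurable D.
  rewrite (_ : D = (X `*` X) `&` [set p | eps <= l2norm (g p.1 - g p.2)]).
    exact: measurable_fun_le mXX (measurable_cst eps) (measurable_l2dist mX mg).
  by apply/seteqP; split=> [p []|p [[]]].
pose h (p : borel_on X * borel_on X) (S : {set M}) :=
  weight m gamma p.1 p.2 S * l2norm (g p.1 - g p.2) ^+ 2.
have h_ge0 p S : 0 <= h p S by rewrite mulr_ge0 ?weight_ge0 ?sqr_ge0.
have mh S : measurable_fun D (h ^~ S).
  apply: (measurable_funS mXX DXX).
  apply: measurable_funM; last exact: measurable_l2distX.
  (* Summing over an enumeration of S makes the index range a plain sequence. *)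
  under eq_fun do rewrite weightE -big_enum.
  apply: measurable_minr; last exact: measurable_cst.
  apply: measurable_sum => j.
  by apply: measurable_funM; [exact: measurable_cst|exact: measurable_l2distX].
move=> f; split.
- rewrite /normalized /f /objective integral0_eq // => p _.
  by rewrite weight_set0 mul0r.
- apply: (nondecreasing_integral (h := h)) => // p.
  by apply: nondecreasing_setfunMr; rewrite ?sqr_ge0//; exact: weight_nondecreasing.
- apply: (submodular_integral (h := h)) => // p.
  by apply: submodularMr; rewrite ?sqr_ge0//; exact: weight_submodular.
Qed.
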